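(* Let $X$ be a complex algebraic variety with arc space $\mathcal L(X)$. Then the ``functionization'' homomorphism $\Psi$ gives a canonical isomorphism $$F^{\mathrm{pro}}(\mathcal L(X))\cong F^{\mathrm{cyl}}(\mathcal L(X)).$$
   Context: The arc space $\mathcal L(X)=\varprojlim_{n\ge0}\mathcal L_n(X)$ is the projective limit of the truncated arc (jet) varieties $\mathcal L_n(X)$ (with $\mathcal L_0(X)=X$) along the truncation morphisms $\pi_{n,n+1}:\mathcal L_{n+1}(X)\to\mathcal L_n(X)$; $\pi_n:\mathcal L(X)\to\mathcal L_n(X)$ is the canonical projection. Varieties are regarded as sets of complex points. $F(V)$ is the group of $\mathbb Z$-valued constructible functions on $V$, with pullback $\pi^*\alpha=\alpha\circ\pi$. $F^{\mathrm{pro}}(\mathcal L(X)):=\varinjlim_n\{F(\mathcal L_n(X)),\pi_{n,n+1}^*\}$ (proconstructible functions). Let $\mathrm{Fun}(\mathcal L(X),\mathbb Z)$ be the group of all functions $\mathcal L(X)\to\mathbb Z$. The functionization homomorphism $\Psi:F^{\mathrm{pro}}(\mathcal L(X))\to\mathrm{Fun}(\mathcal L(X),\mathbb Z)$ is $\Psi([\alpha_n])=\pi_n^*\alpha_n$, i.e. $\Psi([\alpha_n])((x_k)_k)=\alpha_n(x_n)$. $F^{\mathrm{cyl}}(\mathcal L(X)):=\mathrm{Image}(\Psi)=\bigcup_n\pi_n^*(F(\mathcal L_n(X)))$ is the group of cylinder functions, i.e. $\mathbb Z$-linear combinations of characteristic functions of cylinder sets $\pi_n^{-1}(C_n)$ with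 $C_n\subset\mathcal L_n(X)$ constructible. *)

(* Defs.v *)
From HB Require Import structures.
From mathcomp Require Import all_boot all_order all_algebra generic_quotient.
From mathcomp Require Import qpoly mpoly.
From mathcomp Require Import boolp classical_sets functions topology_structure.

Set Implicit Arguments.
Unset Strict Implicit.
Unset Printing Implicit Defensive.

Import GRing.Theory.

Local Open Scope quotient_scope.
Local Open Scope classical_set_scope.
Local Open Scope ring_scope.

Section DirectLimit.
Variables (G : nat -> zmodType) (f : forall n, {additive G n -> G n.+1}).

Definition dl_step (s : {n : nat & G n}) : {n : nat & G n} :=
  Tagged (fun n => G n) (f (tag s) (tagged s)).

(* [(n, a)] and [(m, b)] are identified when they have a common image at some
   later stage; the equation below forces i + n = j + m. *)
Definition dl_rel (s t : {n : nat & G n}) : bool :=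
  `[< exists i j, iter i dl_step s = iter j dl_step t >].

Lemma dl_rel_refl : reflexive dl_rel.
Proof. by move=> s; apply/asboolP; exists 0%N, 0%N. Qed.

Lemma dl_rel_sym : ssrbool.symmetric dl_rel.
Proof.
by move=> s t; apply/idP/idP => /asboolP[i [j e]]; apply/asboolP; exists j, i.
Qed.

Lemma dl_rel_trans : transitive dl_rel.
Proof.
move=> t s u /asboolP[i [j e]] /asboolP[i' [j' e']].
apply/asboolP; exists (i' + i)%N, (j + j')%N.
by rewrite iterD e -iterD addnC iterD e' -iterD.
Qed.

Canonical dl_equiv := EquivRel dl_rel dl_rel_refl dl_rel_sym dl_rel_trans.

Definition dirlim := {eq_quot dl_equiv}.
HB.instance Definition _ := Choice.on dirlim.
HB.instance Definition _ := EqQuotient.on dirlim.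

Definition dl_in n (a : G n) : dirlim :=
  \pi_dirlim (Tagged (fun n => G n) a).

Fixpoint dl_lift i n : G n -> G (i + n)%N :=
  if i is i'.+1 then fun a => f (i' + n) (dl_lift i' a) else id.

Lemma dl_liftB i n : {morph @dl_lift i n : a b / a - b}.
Proof. by elim: i => [//|i IH] a b /=; rewrite IH raddfB. Qed.

Lemma iter_dl_step i n (a : G n) :
  iter i dl_step (Tagged (fun n => G n) a)
  = Tagged (fun n => G n) (dl_lift i a).
Proof. by elim: i => //= i ->. Qed.

Lemma dl_in_eqP n m (a : G n) (b : G m) :
  reflect (exists i j, Tagged (fun n => G n) (dl_lift i a)
                       = Tagged (fun n => G n) (dl_lift j b))
          (dl_in a == dl_in b).
Proof.
rewrite /dl_in eqmodE; apply: (iffP (asboolP _)) => -[i [j e]]; exists i, j;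
  by move: e; rewrite !iter_dl_step.
Qed.

Lemma dl_in_step n (a : G n) : dl_in (f n a) = dl_in a.
Proof. by apply/eqP/dl_in_eqP; exists 0%N, 1%N. Qed.

Lemma dl_in_lift i n (a : G n) : dl_in (dl_lift i a) = dl_in a.
Proof. by elim: i => //= i <-; rewrite dl_in_step. Qed.

Lemma dl_in_surj (x : dirlim) : exists n (a : G n), x = dl_in a.
Proof.
by elim/quotW: x => -[n a]; exists n, a.
Qed.

Lemma dl_in_reach n k (a : G n) : (n <= k)%N ->
  exists b : G k, dl_in a = dl_in b.
Proof.
move=> /subnK <-; exists (dl_lift (k - n) a).
by rewrite dl_in_lift.
Qed.

Lemma dl_in_common2 (x y : dirlim) :
  exists k (a b : G k), x = dl_in a /\ y = dl_in b.
Proof.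
have [n [a ->]] := dl_in_surj x; have [m [b ->]] := dl_in_surj y.
have [a' ea] := dl_in_reach a (leq_maxl n m).
have [b' eb] := dl_in_reach b (leq_maxr n m).
by exists (maxn n m), a', b'.
Qed.

Lemma dl_in_common3 (x y z : dirlim) :
  exists k (a b c : G k), [/\ x = dl_in a, y = dl_in b & z = dl_in c].
Proof.
have [n [a [b [-> ->]]]] := dl_in_common2 x y; have [m [c ->]] := dl_in_surj z.
have [a' ea] := dl_in_reach a (leq_maxl n m).
have [b' eb] := dl_in_reach b (leq_maxl n m).
have [c' ec] := dl_in_reach c (leq_maxr n m).
by exists (maxn n m), a', b', c'.
Qed.

Lemma Tagged_sub n m (a a' : G n) (b b' : G m) :
  Tagged (fun n => G n) a = Tagged (fun n => G n) b ->
  Tagged (fun n => G n) a' = Tagged (fun n => G n) b' ->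
  Tagged (fun n => G n) (a - a') = Tagged (fun n => G n) (b - b').
Proof.
move=> e; have enm : n = m by exact: (congr1 tag e).
move: b b' e; rewrite -enm => b b' e e'.
by rewrite (eq_from_Tagged e) (eq_from_Tagged e').
Qed.

Lemma dl_in_sub n m (a a' : G n) (b b' : G m) :
  dl_in a = dl_in b -> dl_in a' = dl_in b' -> dl_in (a - a') = dl_in (b - b').
Proof.
move=> /eqP/dl_in_eqP[i [j e]] /eqP/dl_in_eqP[i' [j' e']].
have eij : (i + n = j + m)%N by exact: (congr1 tag e).
have eij' : (i' + n = j' + m)%N by exact: (congr1 tag e').
have ej : (i + j' = i' + j)%N.
  by apply/eqP; rewrite -(eqn_add2r m) -!addnA -eij -eij' addnCA.
have E : iter (i' + i) dl_step (Tagged (fun n => G n) a)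
       = iter (i' + j) dl_step (Tagged (fun n => G n) b).
  by rewrite !iterD (iter_dl_step i) (iter_dl_step j) e.
have E' : iter (i' + i) dl_step (Tagged (fun n => G n) a')
        = iter (i' + j) dl_step (Tagged (fun n => G n) b').
  by rewrite -ej (addnC i') !iterD (iter_dl_step i') (iter_dl_step j') e'.
apply/eqP/dl_in_eqP; exists (i' + i)%N, (i' + j)%N.
rewrite !iter_dl_step in E E'.
by rewrite !dl_liftB; apply: Tagged_sub.
Qed.

(* The group operations are computed at any stage where both elements have
   representatives; [dl_inD] and [dl_inN] show that the choice is immaterial. *)
Definition dl_zero : dirlim := dl_in (0 : G 0).

Definition dl_sub (x y : dirlim) : dirlim :=
  let s := iter (tag (repr y)) dl_step (repr x) in
  let t := iter (tag (repr x)) dl_step (repr y) in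
  dl_in (tagged s - tagged_as s t).

Definition dl_opp (x : dirlim) : dirlim := dl_in (- tagged (repr x)).

Definition dl_add (x y : dirlim) : dirlim := dl_sub x (dl_opp y).

Lemma dl_in_repr (x : dirlim) : dl_in (tagged (repr x)) = x.
Proof. by rewrite -[RHS]reprK /dl_in; case: (repr x). Qed.

Lemma dl_in0 n : dl_in (0 : G n) = dl_zero.
Proof.
elim: n => // n <-.
by rewrite -(dl_in_step (0 : G n)) raddf0.
Qed.

Lemma dl_subE n (a b : G n) : dl_sub (dl_in a) (dl_in b) = dl_in (a - b).
Proof.
rewrite /dl_sub.
move: (dl_in_repr (dl_in a)) (dl_in_repr (dl_in b)).
case: (repr (dl_in a)) => k a'; case: (repr (dl_in b)) => m b' /= ea eb.
rewrite !iter_dl_step.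
move: (etrans (dl_in_lift m a') ea) (etrans (dl_in_lift k b') eb).
move: (dl_lift m a') (dl_lift k b') => /=; rewrite (addnC k m) => a1 b1 ea1 eb1.
by rewrite tagged_asE; apply: dl_in_sub.
Qed.

Lemma dl_inN n (a : G n) : dl_opp (dl_in a) = dl_in (- a).
Proof.
have /dl_in_sub := etrans (dl_in0 (tag (repr (dl_in a)))) (esym (dl_in0 n)).
by move=> /(_ _ _ (dl_in_repr (dl_in a))); rewrite !sub0r.
Qed.

Lemma dl_inD n (a b : G n) : dl_add (dl_in a) (dl_in b) = dl_in (a + b).
Proof. by rewrite /dl_add dl_inN dl_subE opprK. Qed.

Lemma dl_addA : associative dl_add.
Proof.
move=> x y z; have [k [a [b [c [-> -> ->]]]]] := dl_in_common3 x y z.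
by rewrite !dl_inD addrA.
Qed.

Lemma dl_addC : commutative dl_add.
Proof.
move=> x y; have [k [a [b [-> ->]]]] := dl_in_common2 x y.
by rewrite !dl_inD addrC.
Qed.

Lemma dl_add0 : left_id dl_zero dl_add.
Proof.
move=> x; have [n [a ->]] := dl_in_surj x.
by rewrite -(dl_in0 n) dl_inD add0r.
Qed.

Lemma dl_addN : left_inverse dl_zero dl_opp dl_add.
Proof.
move=> x; have [n [a ->]] := dl_in_surj x.
by rewrite dl_inN dl_inD addNr dl_in0.
Qed.

HB.instance Definition _ :=
  GRing.isZmodule.Build dirlim dl_addA dl_addC dl_add0 dl_addN.

Lemma dl_in_is_zmod_morphism n : zmod_morphism (@dl_in n).
Proof. by move=> a b; rewrite /GRing.add /GRing.opp /= dl_inN dl_inD. Qed.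

HB.instance Definition _ n :=
  GRing.isZmodMorphism.Build (G n) dirlim (@dl_in n)
    (@dl_in_is_zmod_morphism n).

Section Recursor.
Variables (H : zmodType) (h : forall n, {additive G n -> H}).
Hypothesis hf : forall n (a : G n), h n.+1 (f n a) = h n a.

Definition dl_rec (x : dirlim) : H := h (tag (repr x)) (tagged (repr x)).

Lemma dl_rec_in n (a : G n) : dl_rec (dl_in a) = h n a.
Proof.
have hl i k (b : G k) : h _ (dl_lift i b) = h _ b.
  by elim: i => //= i <-; rewrite hf.
rewrite /dl_rec; move: (dl_in_repr (dl_in a)) => /eqP/dl_in_eqP[i [j e]].
rewrite -(hl i) -(hl j _ a).
exact: (congr1 (fun s : {n & G n} => h (tag s) (tagged s)) e).
Qed.

Lemma dl_rec_is_zmod_morphism : zmod_morphism dl_rec.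
Proof.
move=> x y; have [k [a [b [-> ->]]]] := dl_in_common2 x y.
by rewrite -raddfB !dl_rec_in raddfB.
Qed.
End Recursor.

End DirectLimit.

Section Constructible.
Variable T : topologicalType.

Definition constructible (A : set T) : Prop :=
  exists k (O Z : 'I_k -> set T),
    [/\ forall i, open (O i), forall i, closed (Z i)
      & A = \bigcup_i (O i `&` Z i)].

Definition constr_fun : {pred T -> int} := fun g =>
  `[< exists k (c : 'I_k -> int) (A : 'I_k -> set T),
        (forall i, constructible (A i)) /\
        g = (fun x => \sum_(i < k) c i * (x \in A i)%:R) >].

Lemma constr_fun_zmod_closed : zmod_closed constr_fun.
Proof.
split.
  apply/asboolP; exists 0%N, (fun=> 0), (fun=> set0); split; first by case.
  by apply/funext => x; rewrite big_ord0.
move=> g g' /asboolP[k [c [A [cA ->]]]] /asboolP[k' [c' [A' [cA' ->]]]].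
apply/asboolP; exists (k + k')%N.
exists (fun i => match fintype.split i with inl j => c j | inr j => - c' j end).
exists (fun i => match fintype.split i with inl j => A j | inr j => A' j end).
split=> [i|]; first by case: (fintype.split i).
apply/funext => x; rewrite big_split_ord /= [LHS]/GRing.add /=; congr (_ + _).
  by apply: eq_bigr => i _; rewrite (unsplitK (inl i)).
rewrite [LHS]/GRing.opp /= -sumrN; apply: eq_bigr => i _.
by rewrite (unsplitK (inr i)) mulNr.
Qed.

HB.instance Definition _ :=
  GRing.isZmodClosed.Build (T -> int) constr_fun constr_fun_zmod_closed.

Record constrFun := ConstrFun {
  constrFun_val :> T -> int;
  constrFunP : constrFun_val \in constr_fun }.

HB.instance Definition _ := [isSub for constrFun_val].
HB.instance Definition _ := [Choice of constrFun by <:].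
HB.instance Definition _ := [SubChoice_isSubZmodule of constrFun by <:].

End Constructible.

Section Pullback.
Variables (S T : topologicalType) (h : S -> T).
Hypothesis h_cont : continuous h.

Lemma constructible_preimage (A : set T) :
  constructible A -> constructible (h @^-1` A).
Proof.
move=> [k [O [Z [oO cZ ->]]]].
exists k, (fun i => h @^-1` O i), (fun i => h @^-1` Z i); split.
- by move=> i; move/continuousP: h_cont; apply.
- by move=> i; move/continuous_closedP: h_cont; apply.
- by rewrite preimage_bigcup; under eq_bigcupr do rewrite preimage_setI.
Qed.

Lemma constr_fun_pullback (g : constrFun T) : (g \o h) \in @constr_fun S.
Proof.
case: g => _ /= /asboolP[k [c [A [cA ->]]]]; apply/asboolP.
exists k, c, (fun i => h @^-1` A i); split=> //.
by move=> i; apply: constructible_preimage.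
Qed.

Definition constr_pullback (g : constrFun T) : constrFun S :=
  ConstrFun (constr_fun_pullback g).

Lemma constr_pullback_is_zmod_morphism : zmod_morphism constr_pullback.
Proof. by move=> g g'; apply: val_inj. Qed.

HB.instance Definition _ :=
  GRing.isZmodMorphism.Build (constrFun T) (constrFun S) constr_pullback
    constr_pullback_is_zmod_morphism.

End Pullback.

Section Zariski.
Variables (K : fieldType) (N : nat).

Definition zariski_closed (Z : set ('I_N -> K)) : Prop :=
  exists S : set {mpoly K[N]}, Z = [set x | forall p, S p -> p.@[x] = 0].

Definition zariski_open (O : set ('I_N -> K)) : Prop := zariski_closed (~` O).

Lemma zariski_openP (O : set ('I_N -> K)) :
  zariski_open O <->
  exists S : set {mpoly K[N]}, O = [set x | exists2 p, S p & p.@[x] != 0].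
Proof.
split=> -[S e]; exists S.
  rewrite -[LHS]setCK e; apply/seteqP; split=> x /=.
    move=> /existsNP[p /not_implyP[Sp px]]; exists p => //; exact/eqP.
  by move=> [p Sp px] /(_ p Sp) px0; rewrite px0 eqxx in px.
rewrite e; apply/seteqP; split=> x /=.
  by move=> nx p Sp; apply: contra_notP nx => /eqP; exists p.
by move=> xS [p Sp /eqP]; apply; apply: xS.
Qed.

Lemma zariski_openT : zariski_open setT.
Proof.
apply/zariski_openP; exists [set 1]; apply/seteqP; split=> x //= _.
by exists 1 => //; rewrite meval1 oner_neq0.
Qed.

Lemma zariski_openI O O' :
  zariski_open O -> zariski_open O' -> zariski_open (O `&` O').
Proof.
move=> /zariski_openP[S ->] /zariski_openP[S' ->]; apply/zariski_openP.
exists [set p * q | p in S & q in S']; apply/seteqP; split=> x /=.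
  move=> [[p Sp px] [q Sq qx]]; exists (p * q); first by exists p => //; exists q.
  by rewrite mevalM mulf_neq0.
move=> [_ [p Sp [q Sq <-]]]; rewrite mevalM mulf_eq0 negb_or => /andP[px qx].
by split; [exists p | exists q].
Qed.

Lemma zariski_open_bigcup I (O : I -> set ('I_N -> K)) :
  (forall i, zariski_open (O i)) -> zariski_open (\bigcup_i O i).
Proof.
move=> oO; have /choice[S eS] i := (zariski_openP (O i)).1 (oO i).
apply/zariski_openP; exists (\bigcup_i S i); apply/seteqP; split=> x /=.
  by move=> [i _]; rewrite eS => -[p Sp px]; exists p => //; exists i.
by move=> [p [i _ Sp] px]; exists i => //; rewrite eS; exists p.
Qed.

End Zariski.

Lemma zariski_open_reindex (K : fieldType) N M (h : 'I_N -> 'I_M)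
    (O : set ('I_N -> K)) :
  zariski_open O -> zariski_open [set x : 'I_M -> K | O (x \o h)].
Proof.
move=> /zariski_openP[S ->]; apply/zariski_openP.
pose lq : N.-tuple {mpoly K[M]} := [tuple 'X_(h i) | i < N].
have lqE (x : 'I_M -> K) (p : {mpoly K[N]}) : (p \mPo lq).@[x] = p.@[x \o h].
  rewrite comp_mpoly_meval; congr (_.@[_]); apply/funext => i /=.
  by rewrite tnth_mktuple mevalXU.
exists [set p \mPo lq | p in S]; apply/seteqP; split=> x /=.
  by move=> [p Sp px]; exists (p \mPo lq); [exists p | rewrite lqE].
by move=> [_ [p Sp <-]]; rewrite lqE; exists p.
Qed.

Section Varieties.
Variable K : fieldType.

Section SpaceWithFunctions.
(* [reg x f]: the K-valued function f is regular in a neighbourhood of x. This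
   is the sheaf of regular functions given by its germs: f is a section over an
   open set W when [reg x f] holds for all x in W. *)
Variables (X : topologicalType) (reg : X -> set (X -> K)).

(* y is an isomorphism of the open subspace U onto a Zariski closed subset of
   K^N, with its Zariski topology and the sheaf of functions that are locally
   quotients of polynomials; values of y outside U are irrelevant. *)
Definition affine_chart (U : set X) (N : nat) (y : X -> 'I_N -> K) : Prop :=
  [/\ open U,
      {in U &, injective y},
      zariski_closed (y @` U),
      forall W, W `<=` U ->
        (open W <-> exists2 O, zariski_open O & W = U `&` y @^-1` O)
    & forall x f, U x ->
        (reg x f <-> exists p q : {mpoly K[N]},
           \forall z \near x, q.@[y z] != 0 /\ f z = p.@[y z] / q.@[y z])].

Definition affine_open (U : set X) : Prop :=
  exists N (y : X -> 'I_N -> K), affine_chart U y.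

Definition pair_coords N M (y : X -> 'I_N -> K) (z : X -> 'I_M -> K) (x : X) :
    'I_(N + M) -> K :=
  fun k => match fintype.split k with inl i => y x i | inr j => z x j end.

(* The diagonal of X x X is closed: the products of affine charts cover X x X,
   and the trace of the diagonal on such a product is the image of U `&` V. *)
Definition separated_space : Prop :=
  forall U V N M (y : X -> 'I_N -> K) (z : X -> 'I_M -> K),
    affine_chart U y -> affine_chart V z ->
    zariski_closed (pair_coords y z @` (U `&` V)).

End SpaceWithFunctions.

(* Reduced separated schemes of finite type over K (for K algebraically
   closed), seen through their K-points; irreducibility is not required. *)
Record variety := Variety {
  vpoint :> topologicalType;
  regular_at : vpoint -> set (vpoint -> K);
  variety_cover : exists k (U : 'I_k -> set vpoint),
    (forall i, affine_open regular_at (U i)) /\ \bigcup_i U i = setT;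
  variety_separated : separated_space regular_at }.

End Varieties.

Section Jets.
Variables (K : fieldType) (X : variety K).

(* A K-point of the n-th jet scheme, i.e. a morphism from Spec K[t]/(t^(n+1))
   to X: a point x and a local homomorphism of K-algebras from the local ring of
   X at x to K[t]/(t^(n+1)). The homomorphism is given on functions that are
   regular near x, depends only on their germs at x, and takes the dummy value 0
   on all other functions, so that equality of jets is as it should be. *)
Record jet (n : nat) := Jet {
  jet_base : X;
  jet_map :> (X -> K) -> {poly %/ ('X^(n.+1) : {poly K})};
  jet_germ : forall f g : X -> K,
    (\forall z \near jet_base, f z = g z) -> jet_map f = jet_map g;
  jet_cst : forall c : K, jet_map (cst c) = qpolyC 'X^(n.+1) c;
  jet_add : forall f g : X -> K,
    regular_at jet_base f -> regular_at jet_base g ->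
    jet_map (f \+ g) = jet_map f + jet_map g;
  jet_mul : forall f g : X -> K,
    regular_at jet_base f -> regular_at jet_base g ->
    jet_map (f \* g) = jet_map f * jet_map g;
  jet_local : forall f : X -> K,
    regular_at jet_base f -> (jet_map f)`_0 = f jet_base;
  jet_out : forall f : X -> K, ~ regular_at jet_base f -> jet_map f = 0 }.

HB.instance Definition _ n := gen_eqMixin (jet n).
HB.instance Definition _ n := gen_choiceMixin (jet n).

(* Coefficients of t^j, j <= n, of the N coordinates of a jet in a chart. *)
Definition jet_coords n N (y : X -> 'I_N -> K) (g : jet n) :
    'I_(N * n.+1) -> K :=
  fun k => mxvec (\matrix_(i < N, j < n.+1) (g (fun z => y z i))`_j) 0 k.

(* Zariski topology of the n-th jet variety of X: for every affine open U of X
   the jets based in U form an open subset, which is embedded as a closed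
   subvariety of affine space by the coordinates of jets. *)
Definition jet_open n (A : set (jet n)) : Prop :=
  forall U N (y : X -> 'I_N -> K), affine_chart (@regular_at K X) U y ->
    exists2 O, zariski_open O
             & forall g : jet n, U (jet_base g) -> (A g <-> O (jet_coords y g)).

Lemma jet_openT n : jet_open (@setT (jet n)).
Proof. by move=> U N y _; exists setT => //; exact: zariski_openT. Qed.

Lemma jet_openI n : setI_closed (@jet_open n).
Proof.
move=> A B oA oB U N y Uy.
have [O oO AO] := oA _ _ _ Uy; have [O' oO' BO'] := oB _ _ _ Uy.
exists (O `&` O'); first exact: zariski_openI.
move=> g Ug; have [? ?] := AO g Ug; have [? ?] := BO' g Ug.
by split=> -[]; split; auto.
Qed.

Lemma jet_open_bigcup n (I : Type) (A : I -> set (jet n)) :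
  (forall i, jet_open (A i)) -> jet_open (\bigcup_i A i).
Proof.
move=> oA U N y Uy.
have /choice[O OP] i : exists O, zariski_open O /\ forall g : jet n,
    U (jet_base g) -> (A i g <-> O (jet_coords y g)).
  by have [O] := oA i _ _ _ Uy; exists O.
exists (\bigcup_i O i); first by apply: zariski_open_bigcup => i; case: (OP i).
move=> g Ug.
by split=> -[i _ Ai]; exists i => //; case: (OP i) => _ /(_ g Ug)[]; auto.
Qed.

HB.instance Definition _ n := isOpenTopological.Build (jet n)
  (@jet_openT n) (@jet_openI n) (@jet_open_bigcup n).

Lemma jet_openE n : (open : set (set (jet n))) = @jet_open n.
Proof. by []. Qed.

Section Truncation.
Variable n : nat.

Definition qtrunc (p : {poly %/ ('X^(n.+2) : {poly K})}) :
    {poly %/ ('X^(n.+1) : {poly K})} := in_qpoly 'X^(n.+1) p.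

Lemma in_qpoly_coef m (p : {poly K}) k :
  (in_qpoly 'X^(m.+1) p)`_k = if (k < m.+1)%N then p`_k else 0.
Proof.
by rewrite /= mk_monic_Xn /= -Pdiv.RingMonic.take_poly_rmodp coef_take_poly.
Qed.

Lemma qtrunc_coef p k : (qtrunc p)`_k = if (k < n.+1)%N then p`_k else 0.
Proof. exact: in_qpoly_coef. Qed.

Lemma qtruncC c : qtrunc (qpolyC _ c) = qpolyC _ c.
Proof.
apply/npolyP => k; rewrite qtrunc_coef /= coefC.
by case: k => //= k; rewrite if_same.
Qed.

Lemma qtruncD p q : qtrunc (p + q) = qtrunc p + qtrunc q.
Proof. exact: in_qpolyD. Qed.

Lemma qtruncM p q : qtrunc (p * q) = qtrunc p * qtrunc q.
Proof.
rewrite -in_qpolyM; apply/npolyP => k.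
change (p * q) with (in_qpoly 'X^(n.+2) ((p : {poly K}) * q)).
rewrite qtrunc_coef !in_qpoly_coef; case: ifP => // kn.
by rewrite ltnW.
Qed.

Variable g : jet n.+1.

Definition trunc_map (f : X -> K) : {poly %/ ('X^(n.+1) : {poly K})} :=
  qtrunc (g f).

Lemma trunc_germ (f h : X -> K) :
  (\forall z \near jet_base g, f z = h z) -> trunc_map f = trunc_map h.
Proof. by move=> fh; rewrite /trunc_map (jet_germ fh). Qed.

Lemma trunc_cst c : trunc_map (cst c) = qpolyC _ c.
Proof. by rewrite /trunc_map jet_cst qtruncC. Qed.

Lemma trunc_add (f h : X -> K) :
  regular_at (jet_base g) f -> regular_at (jet_base g) h ->
  trunc_map (f \+ h) = trunc_map f + trunc_map h.
Proof. by move=> rf rh; rewrite /trunc_map jet_add// qtruncD. Qed.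

Lemma trunc_mul (f h : X -> K) :
  regular_at (jet_base g) f -> regular_at (jet_base g) h ->
  trunc_map (f \* h) = trunc_map f * trunc_map h.
Proof. by move=> rf rh; rewrite /trunc_map jet_mul// qtruncM. Qed.

Lemma trunc_local (f : X -> K) :
  regular_at (jet_base g) f -> (trunc_map f)`_0 = f (jet_base g).
Proof. by move=> rf; rewrite qtrunc_coef jet_local. Qed.

Lemma trunc_out (f : X -> K) :
  ~ regular_at (jet_base g) f -> trunc_map f = 0.
Proof. by move=> rf; rewrite /trunc_map jet_out// /qtrunc in_qpoly0. Qed.

Definition trunc : jet n :=
  Jet trunc_germ trunc_cst trunc_add trunc_mul trunc_local trunc_out.

End Truncation.

Lemma trunc_continuous n : continuous (@trunc n).
Proof.
apply/continuousP => A; rewrite !jet_openE => oA U N y Uy.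
have [O oO AO] := oA _ _ _ Uy.
have /choice[h hP] (k : 'I_(N * n.+1)) : exists k' : 'I_(N * n.+2),
    forall g : jet n.+1, jet_coords y (trunc g) k = jet_coords y g k'.
  case/mxvec_indexP: k => i j; exists (mxvec_index i (widen_ord (leqnSn _) j)).
  by move=> g; rewrite /jet_coords !mxvecE !mxE [LHS]qtrunc_coef ltn_ord.
exists [set x : 'I_(N * n.+2) -> K | O (x \o h)].
  exact: zariski_open_reindex.
move=> g Ug /=; rewrite /preimage /mkset (AO (trunc g) Ug) /=.
by have -> : jet_coords y (trunc g) = jet_coords y g \o h
  by apply/funext => k; rewrite hP.
Qed.

Record arc_space := Arc {
  arc_jet : forall n, jet n;
  arc_compat : forall n, trunc (arc_jet n.+1) = arc_jet n }.

Definition jet_pullback n :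
    {additive constrFun (jet n) -> constrFun (jet n.+1)} :=
  constr_pullback (@trunc_continuous n).

Definition Fpro : zmodType := dirlim jet_pullback.

Definition arc_pullback n (a : constrFun (jet n)) : arc_space -> int :=
  fun x => a (arc_jet x n).

Lemma arc_pullback_is_zmod_morphism n : zmod_morphism (@arc_pullback n).
Proof. by []. Qed.

HB.instance Definition _ n :=
  GRing.isZmodMorphism.Build (constrFun (jet n)) (arc_space -> int) (@arc_pullback n)
    (@arc_pullback_is_zmod_morphism n).

Lemma arc_pullback_compat n (a : constrFun (jet n)) :
  arc_pullback (jet_pullback n a) = arc_pullback a.
Proof.
by apply/funext => x; rewrite /arc_pullback /= arc_compat.
Qed.

(* The functionization homomorphism: by [Psi_in] below, the class of a
   constructible function a on the n-th jet variety is sent to the function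
   (x_k)_k |-> a x_n on arcs. *)
Definition Psi : Fpro -> (arc_space -> int) :=
  dl_rec (fun n => @arc_pullback n : {additive _ -> _}).

Lemma Psi_in n (a : constrFun (jet n)) :
  Psi (dl_in jet_pullback a) = arc_pullback a.
Proof. exact: (dl_rec_in arc_pullback_compat). Qed.

Lemma Psi_is_zmod_morphism : zmod_morphism Psi.
Proof. exact: (dl_rec_is_zmod_morphism arc_pullback_compat). Qed.

HB.instance Definition _ :=
  GRing.isZmodMorphism.Build Fpro (arc_space -> int) Psi Psi_is_zmod_morphism.

Definition cylinder_fun : {pred arc_space -> int} := fun b => `[< range Psi b >].

Lemma cylinder_funP (b : arc_space -> int) :
  reflect (exists n (a : constrFun (jet n)), b = arc_pullback a)
          (b \in cylinder_fun).
Proof.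
apply: (iffP (asboolP _)) => [[a _ <-]|[n [a ->]]].
  by have [n [a' ->]] := dl_in_surj a; exists n, a'; rewrite Psi_in.
by exists (dl_in jet_pullback a) => //; rewrite Psi_in.
Qed.

Lemma cylinder_fun_zmod_closed : zmod_closed cylinder_fun.
Proof.
split; first by apply/asboolP; exists 0 => //; rewrite raddf0.
move=> _ _ /asboolP[a _ <-] /asboolP[b _ <-].
by apply/asboolP; exists (a - b) => //; rewrite raddfB.
Qed.

HB.instance Definition _ :=
  GRing.isZmodClosed.Build (arc_space -> int) cylinder_fun cylinder_fun_zmod_closed.

Record Fcyl := CylinderFun {
  Fcyl_val :> arc_space -> int;
  FcylP : Fcyl_val \in cylinder_fun }.

HB.instance Definition _ := [isSub for Fcyl_val].
HB.instance Definition _ := [Choice of Fcyl by <:].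
HB.instance Definition _ := [SubChoice_isSubZmodule of Fcyl by <:].

End Jets.

(* Main.v *)
Require Import Defs.
From HB Require Import structures.
From mathcomp Require Import all_boot all_order all_algebra.
From mathcomp Require Import qpoly mpoly closed_field.
From mathcomp Require Import boolp classical_sets functions.
From mathcomp Require Import filter topology_structure.
From mathcomp Require Import reals complex.
From mathcomp Require lebesgue_measure.

(** The image of [Psi] is the group of cylinder functions by definition, so only
injectivity needs a proof: a constructible function [a] on the [n]-th jet
variety whose pullback to every higher jet variety is nonzero must be nonzero at
some arc ([Psi_injective]). Truncations need not be surjective when the variety
is singular, so a jet in the support of [a] need not lift to an arc.

The arc is found by a compactness argument that replaces Greenberg's theorem and
rests on the uncountability of the complex numbers. Finitely many affine charts
cover the variety, and jets truncate within a chart, so one chart contains jets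
of every order above the support of [a]. In that chart an arc is a sequence of
scalars, the coefficients of its coordinates, and the condition that the first
of them belong to a jet of order [m] above the support of [a] is a first-order
condition [E m] on finitely many of them. These conditions decrease with [m] and
each can be satisfied; [definable_saturation] satisfies all of them at once. It
chooses the scalars one after the other: the values allowed by [E m] for the
next scalar form a definable subset of the line, which is finite or cofinite by
quantifier elimination ([definable_line]), and a decreasing sequence of nonempty
such sets has a common point, because either it becomes constant or its
complement is countable ([complex_avoids_roots]).

Two facts make [E m] first-order. Zariski open sets are defined by finitely many
polynomials ([zariski_open_finite], Noetherianity), so constructible conditions
on jets are definable ([jet_definable_fiber]). And a tuple of truncated
polynomials is the coordinate tuple of a jet exactly when it annihilates the
polynomials that vanish on the chart ([jet_of_coordinates]); as a jet in a chart
is determined by its coordinates ([jet_chart_inj]), the chosen scalars yield one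
jet of each order, and these form an arc. *)

Set Implicit Arguments.
Unset Strict Implicit.
Unset Printing Implicit Defensive.

Import Order.TTheory GRing.Theory Num.Theory.

Local Open Scope classical_set_scope.
Local Open Scope ring_scope.

(** * Noetherianity of affine space *)

Lemma nondecreasing_subsequence (u : nat -> nat) :
  exists2 g : nat -> nat, {homo g : i j / (i < j)%N}
                        & {homo u \o g : i j / (i <= j)%N}.
Proof.
have argmin k : exists i, (k <= i)%N /\ forall j, (k <= j -> u i <= u j)%N.
  have exP : exists m, `[< exists2 i, (k <= i)%N & u i = m >].
    by exists (u k); apply/asboolP; exists k.
  case: (ex_minnP exP) => m /asboolP[i ki <-] min_m.
  by exists i; split=> // j kj; apply: min_m; apply/asboolP; exists j.
have [next nextP] := choice argmin.
pose g := fix g k := if k is k'.+1 then next (g k').+1 else next 0%N.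
exists g.
  by apply: homo_ltn => [? ? ?|k]; [exact: ltn_trans|case: (nextP (g k).+1)].
apply: homo_leq => [//|? ? ?|k /=]; first exact: leq_trans.
have gk : (g k < next (g k).+1)%N by case: (nextP (g k).+1).
case: k gk => [|k] gk; first by case: (nextP 0%N) => _; apply.
case: (nextP (g k).+1) => _; apply; apply: leq_trans (ltnW gk).
by case: (nextP (g k).+1).
Qed.

(** Passing to a subsequence for one coordinate after the other makes all
coordinates nondecreasing. *)
Lemma dickson n (u : nat -> 'X_{1..n}) :
  exists i j, (i < j)%N /\ (u i <= u j)%MM.
Proof.
suff [g gi gu] : exists2 g : nat -> nat, {homo g : i j / (i < j)%N} &
    forall k : 'I_n, {homo (fun i => u (g i) k) : i j / (i <= j)%N}.
  exists (g 0), (g 1); split; first exact: gi.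
  by apply/mnm_lepP => k; apply: gu.
suff step r : exists2 g : nat -> nat, {homo g : i j / (i < j)%N} &
    forall k : 'I_n, (k < r)%N -> {homo (fun i => u (g i) k) : i j / (i <= j)%N}.
  by have [g gi gu] := step n; exists g => // k; apply: gu.
elim: r => [|r [g gi gu]]; first by exists id.
case: (ltnP r n) => [rn|nr]; last first.
  by exists g => // k _; apply: gu; apply: leq_trans nr.
have [h hi hu] := nondecreasing_subsequence (fun i => u (g i) (Ordinal rn)).
exists (g \o h) => [i j ij|k]; first by apply/gi/hi.
rewrite ltnS leq_eqVlt => /orP[/eqP kr|kr] i j ij /=.
  by rewrite (_ : k = Ordinal rn); [exact: hu|apply: val_inj].
apply: gu => //.
have := ij; rewrite leq_eqVlt => /orP[/eqP-> //|]; by move/hi/ltnW.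
Qed.

(** Hilbert's basis theorem for zero sets. If no finite part of the vanishing
ideal [I] cut out the closed set, one could keep choosing an element of [I] of
least leading monomial among those that do not vanish on the common zeros of the
previous choices. By Dickson's lemma some leading monomial divides a later one,
and cancelling it gives an element that the minimality of the later choice
forbids. *)
Lemma zariski_open_finite (K : fieldType) N (O : set ('I_N -> K)) :
  zariski_open O ->
  exists F : seq {mpoly K[N]}, O = [set x | has (fun p => p.@[x] != 0) F].
Proof.
move=> /zariski_openP[S ->].
pose I : set {mpoly K[N]} :=
  [set p | forall x, (forall q, S q -> q.@[x] = 0) -> p.@[x] = 0].
pose sub_I (F : seq {mpoly K[N]}) := forall p, p \in F -> I p.
pose new (F : seq {mpoly K[N]}) (p : {mpoly K[N]}) :=
  I p /\ exists2 x, (forall q, q \in F -> q.@[x] = 0) & p.@[x] != 0.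
have [[F [FI nF]]|/forallNP stuck] :=
    pselect (exists F, sub_I F /\ ~ exists p, new F p).
  exists F; apply/seteqP; split => x /=; last first.
    move=> /hasP[p pF px]; apply: contrapT => nS; move/eqP: px; apply.
    apply: FI => // q Sq; apply: contrapT => /eqP qx; apply: nS.
    by exists q.
  move=> [p Sp px]; apply: contrapT => /negP/hasPn Fx; apply: nF.
  exists p; split; first by move=> y; apply.
  by exists x => // q /Fx; rewrite negbK => /eqP.
have minimal F : exists p, sub_I F ->
    new F p /\ forall q, new F q -> ~ (mlead q < mlead p)%O.
  have [FI|] := pselect (sub_I F); last by exists 0.
  have [p newp] : exists p, new F p.
    by apply: contrapT => nF; apply: (stuck F).
  move pm: (mlead p) => m.
  elim/(well_founded_ind (@ltom_wf N)): m p pm newp => m IH p pm newp.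
  have [[q [newq qp]]|no] := pselect (exists q, new F q /\ (mlead q < mlead p)%O).
    by apply: (IH (mlead q)) newq; rewrite // -pm.
  by exists p => _; split=> // q newq qp; apply: no; exists q.
have [next nextP] := choice minimal.
pose s := fix s k := if k is k'.+1 then next (s k') :: s k' else [::].
have sI k : sub_I (s k).
  elim: k => [//|k IH] p; rewrite inE => /orP[/eqP->|]; last exact: IH.
  by case: (nextP _ IH) => -[].
pose u k := next (s k).
have newu k : new (s k) (u k) by case: (nextP _ (sI k)).
have us i j : (i < j)%N -> u i \in s j.
  elim: j => // j IH; rewrite ltnS leq_eqVlt => /orP[/eqP->|/IH uj] /=.
    exact: mem_head.
  by rewrite inE uj orbT.
have [i [j [ij lij]]] := dickson (fun k => mlead (u k)).
pose c := mleadc (u j) / mleadc (u i).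
pose q := u j - (c *: 'X_[(mlead (u j) - mlead (u i))]) * u i.
have ui0 : u i != 0.
  by case: (newu i) => _ [x _]; apply: contraNneq => ->; rewrite meval0.
have newq : new (s j) q.
  case: (newu j) => Iuj [x sjx ujx]; split.
    move=> y Sy; rewrite /q mevalB mevalM Iuj//.
    by have [Iui _] := newu i; rewrite Iui// mulr0 subr0.
  exists x => //; rewrite /q mevalB mevalM (sjx (u i)) ?mulr0 ?subr0//.
  exact: us.
have [_ /(_ q newq) []] := nextP _ (sI j); rewrite -/(u j).
have q0 : q != 0.
  by case: newq => _ [x _]; apply: contraNneq => ->; rewrite meval0.
rewrite lt_neqAle; apply/andP; split.
  apply: contraTneq (mlead_supp q0) => ->.
  rewrite mcoeff_msupp negbK /q mcoeffB -scalerAl mcoeffZ.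
  have -> : ('X_[(mlead (u j) - mlead (u i))] * u i)@_(mlead (u j))
            = mleadc (u i).
    by rewrite mulrC -{1}(submK lij) mcoeffMX.
  by rewrite /c divfK ?subrr// mleadc_eq0.
apply: le_trans (mleadB_le _ _) _; rewrite leUx lexx /=.
rewrite -scalerAl; apply: le_trans (mleadZ_le _ _) _.
by apply: le_trans (mleadM_le _ _) _; rewrite mleadXm submK.
Qed.

(** * Definable sets over an algebraically closed field *)

(** This says that [K] is uncountable, in the form in which it is used: no
countable union of finite sets is [K]. *)
Definition avoids_roots (K : fieldType) := forall p : nat -> {poly K},
  (forall m, p m != 0) -> exists a, forall m, ~~ root (p m) a.

Section Definable.
Variable K : closedFieldType.
Implicit Types (D : set (seq K)) (e : seq K) (k : nat).

(** The quantifier-free form makes Boolean operations immediate and bounds the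
variables involved; nothing is lost, by [definable_exists]. The constants of
formulas range over [K], so parameters are allowed. Environments are sequences
padded with 0, as for formulas of the language of rings. *)
Definition definable D := exists2 f : GRing.formula K,
  GRing.qf_form f && GRing.rformula f & D = [set e | GRing.qf_eval e f].

Lemma definable0 : definable set0.
Proof. by exists (GRing.Bool false) => //; apply/seteqP; split. Qed.

Lemma definableC D : definable D -> definable (~` D).
Proof.
move=> [f ff ->]; exists (GRing.Not f) => //.
by apply/seteqP; split => e /= /negP.
Qed.

Lemma definableI D D' : definable D -> definable D' -> definable (D `&` D').
Proof.
move=> [f /andP[ff rf] ->] [f' /andP[ff' rf'] ->].
exists (GRing.And f f'); first by rewrite /= ff ff' rf.
by apply/seteqP; split => e /= /andP.
Qed.

Lemma definableU D D' : definable D -> definable D' -> definable (D `|` D').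
Proof.
move=> dD dD'; rewrite -[X in definable X]setCK setCU.
by apply/definableC/definableI; apply: definableC.
Qed.

(** By elimination of the existential quantifiers on the variables in [I]. *)
Lemma definable_exists (I : seq nat) D : definable D ->
  definable [set e | exists2 e', {in [predC I], GRing.same_env e e'} & D e'].
Proof.
move=> [f /andP[ff rf] ->].
pose qe := GRing.quantifier_elim (@ClosedFieldQE.ex_elim K).
have rI : GRing.rformula (foldr GRing.Exists f I) by elim: I.
exists (qe (foldr GRing.Exists f I)).
  exact: GRing.quantifier_elim_wf (@ClosedFieldQE.ex_elim_qf K) _ rI.
have qeP e := GRing.quantifier_elim_rformP (@ClosedFieldQE.ex_elim_qf K)
  (ClosedFieldQE.holds_ex_elim (@solve_monicpoly K)) e rI.
apply/seteqP; split => e /=.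
  move=> [e' ee' fe']; apply/qeP/GRing.foldExistsP; exists e' => //.
  exact/GRing.qf_evalP.
move=> /qeP/GRing.foldExistsP[e' ee' fe']; exists e' => //.
exact/GRing.qf_evalP.
Qed.

Lemma eq_eval_below (t : GRing.term K) e e' :
  (forall v, (v < GRing.ub_var t)%N -> e`_v = e'`_v) ->
  GRing.eval e t = GRing.eval e' t.
Proof.
elim: t => //=.
- by move=> v /(_ v (leqnn _)).
- move=> t IH t' IH' ee'.
  by rewrite IH ?IH' // => v vt; apply: ee'; rewrite leq_max vt ?orbT.
- by move=> t IH /IH ->.
- by move=> t IH n /IH ->.
- move=> t IH t' IH' ee'.
  by rewrite IH ?IH' // => v vt; apply: ee'; rewrite leq_max vt ?orbT.
- by move=> t IH /IH ->.
- by move=> t IH n /IH ->.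
Qed.

Lemma definable_bounded D : definable D ->
  exists M, forall e e', (forall v, (v < M)%N -> e`_v = e'`_v) -> D e -> D e'.
Proof.
move=> [f /andP[ff _] ->] /=.
suff [M fM] : exists M, forall e e', (forall v, (v < M)%N -> e`_v = e'`_v) ->
    GRing.qf_eval e f = GRing.qf_eval e' f.
  by exists M => e e' /fM /= ->.
have two f1 f2 (b : bool -> bool -> bool) :
    (exists M, forall e e', (forall v, (v < M)%N -> e`_v = e'`_v) ->
      GRing.qf_eval e f1 = GRing.qf_eval e' f1) ->
    (exists M, forall e e', (forall v, (v < M)%N -> e`_v = e'`_v) ->
      GRing.qf_eval e f2 = GRing.qf_eval e' f2) ->
    exists M, forall e e', (forall v, (v < M)%N -> e`_v = e'`_v) ->
      b (GRing.qf_eval e f1) (GRing.qf_eval e f2) =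
      b (GRing.qf_eval e' f1) (GRing.qf_eval e' f2).
  move=> [M1 H1] [M2 H2]; exists (maxn M1 M2) => e e' ee'.
  by rewrite (H1 e e') ?(H2 e e') // => v vM; apply: ee';
    rewrite leq_max vM ?orbT.
elim: f ff => //=.
- by move=> b _; exists 0%N.
- move=> t1 t2 _; exists (maxn (GRing.ub_var t1) (GRing.ub_var t2)) => e e' ee'.
  by congr (_ == _); apply: eq_eval_below => v vM; apply: ee';
    rewrite leq_max vM ?orbT.
- move=> t _; exists (GRing.ub_var t) => e e' ee'.
  by rewrite (eq_eval_below ee').
- by move=> f1 IH1 f2 IH2 /andP[/IH1 H1 /IH2 H2]; apply: (two _ _ andb).
- by move=> f1 IH1 f2 IH2 /andP[/IH1 H1 /IH2 H2]; apply: (two _ _ orb).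
- by move=> f1 IH1 f2 IH2 /andP[/IH1 H1 /IH2 H2]; apply: (two _ _ implb).
- by move=> f IH /IH[M H]; exists M => e e' /H ->.
Qed.

(** Membership in [D] depends on finitely many variables only, so that fixing
the first [k] of them takes finitely many existential quantifiers. *)
Lemma definable_projection k D : definable D ->
  definable [set e | exists2 e', D e' & forall v, (v < k)%N -> e'`_v = e`_v].
Proof.
move=> dD; have [M DM] := definable_bounded dD.
have := definable_exists (iota k (M - k)) dD; congr definable.
apply/seteqP; split => e /= [e'].
  move=> ee' De'; exists e' => // v vk; apply/esym/ee'.
  by rewrite inE mem_iota leqNgt vk.
move=> De' ee'.
(* e' modified outside the variables of D, where it must agree with e *)
pose e2 := mkseq (fun v => if (v < M)%N then e'`_v else e`_v) (maxn M (size e)).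
have e2E v : e2`_v = if (v < M)%N then e'`_v else e`_v.
  have [vM|vM] := ltnP v (maxn M (size e)); first by rewrite nth_mkseq.
  move: (vM); rewrite geq_max => /andP[Mv ev].
  by rewrite nth_default ?size_mkseq// ltnNge Mv /= nth_default.
exists e2; last by apply: DM De' => v vM; rewrite e2E vM.
move=> v; rewrite inE mem_iota e2E; case: (ltnP v M) => // vM.
case: (ltnP v k) => [/ee' -> //|kv] /=.
by rewrite subnKC ?vM// (leq_trans kv) // ltnW.
Qed.

(** A definable subset of a line is finite or cofinite. Off the roots of the
nonzero polynomials that occur in the formula, all its atoms have constant truth
value. *)
Lemma definable_line e k D : definable D -> exists2 p : {poly K}, p != 0 &
  (forall a, ~~ root p a -> D (set_nth 0 e k a)) \/
  (forall a, ~~ root p a -> ~ D (set_nth 0 e k a)).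
Proof.
move=> [f /andP[ff rf] ->] /=.
suff [p p0 [b pb]] : exists2 p : {poly K}, p != 0 & exists b, forall a,
    ~~ root p a -> GRing.qf_eval (set_nth 0 e k a) f = b.
  by exists p => //; case: b pb => pb; [left|right] => a /pb ->.
have two f1 f2 (op : bool -> bool -> bool) :
    (exists2 p : {poly K}, p != 0 & exists b, forall a,
      ~~ root p a -> GRing.qf_eval (set_nth 0 e k a) f1 = b) ->
    (exists2 p : {poly K}, p != 0 & exists b, forall a,
      ~~ root p a -> GRing.qf_eval (set_nth 0 e k a) f2 = b) ->
    exists2 p : {poly K}, p != 0 & exists b, forall a, ~~ root p a ->
      op (GRing.qf_eval (set_nth 0 e k a) f1)
         (GRing.qf_eval (set_nth 0 e k a) f2) = b.
  move=> [p p0 [b pb]] [q q0 [c qc]]; exists (p * q); first by rewrite mulf_neq0.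
  by exists (op b c) => a; rewrite rootM negb_or => /andP[/pb -> /qc ->].
elim: f ff rf => //=.
- by move=> b _ _; exists 1; [exact: oner_neq0|exists b].
- move=> t1 t2 _ /andP[r1 r2].
  pose P t := ClosedFieldQE.eval_poly e (ClosedFieldQE.abstrX k t).
  have PE t a : GRing.rterm t -> GRing.eval (set_nth 0 e k a) t = (P t).[a].
    by move=> rt; rewrite ClosedFieldQE.abstrXP.
  have [P12|P12] := eqVneq (P t1 - P t2) 0.
    exists 1; first exact: oner_neq0.
    by exists true => a _; rewrite !PE// (subr0_eq P12) eqxx.
  exists (P t1 - P t2) => //; exists false => a.
  by rewrite rootE hornerD hornerN subr_eq0 !PE// => /negbTE.
- move=> f1 IH1 f2 IH2 /andP[/IH1 {}IH1 /IH2 {}IH2] /andP[/IH1 H1 /IH2 H2].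
  exact: (two _ _ andb).
- move=> f1 IH1 f2 IH2 /andP[/IH1 {}IH1 /IH2 {}IH2] /andP[/IH1 H1 /IH2 H2].
  exact: (two _ _ orb).
- move=> f1 IH1 f2 IH2 /andP[/IH1 {}IH1 /IH2 {}IH2] /andP[/IH1 H1 /IH2 H2].
  exact: (two _ _ implb).
- move=> f IH /IH {}IH /IH[p p0 [b pb]]; exists p => //; exists (~~ b) => a.
  by move=> /pb ->.
Qed.

Lemma zariski_open_definable M (h : 'I_M -> nat) (O : set ('I_M -> K)) :
  zariski_open O -> definable [set e | O (fun i => e`_(h i))].
Proof.
move=> /zariski_open_finite[F ->]; elim: F => [|p F IH] /=.
  have := definable0; congr definable; apply/seteqP; split => e //=.
pose t : GRing.term K := foldr GRing.Add (0 : GRing.term K)%T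
  [seq GRing.Mul (GRing.Const p@_m)
         (foldr GRing.Mul (1 : GRing.term K)%T
           [seq GRing.Exp (GRing.Var K (h i)) (m i) | i <- enum 'I_M])
     | m : 'X_{1..M} <- msupp p].
have rt : GRing.rterm t.
  rewrite /t; elim: (msupp p) => //= m s ->; rewrite andbT.
  by elim: (enum 'I_M).
have tE e : GRing.eval e t = p.@[fun i => e`_(h i)].
  rewrite mevalE /t; elim: (msupp p) => [|m s /= ->]; first by rewrite big_nil.
  rewrite big_cons; congr (_ * _ + _); rewrite -big_enum /=.
  elim: (enum 'I_M) => [|i s' /= ->]; first by rewrite big_nil.
  by rewrite big_cons.
have dt : definable [set e | p.@[fun i => e`_(h i)] != 0].
  exists (GRing.Not (GRing.Equal t 0%T)); first by rewrite /= rt.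
  by apply/seteqP; split => e /=; rewrite tE.
have := definableU dt IH; congr definable.
by apply/seteqP; split => e /= /orP.
Qed.

Hypothesis uncountable : avoids_roots K.

(** The sequence [a] is built one term at a time, keeping every [D m]
satisfiable with the terms chosen so far. For the next term, let [C m] be the
set of values that [D m] allows. If all the [C m] are cofinite, they have a
common element by uncountability; if some [C m0] is finite and each of its
elements is excluded by some [C m], then a single [C M] excludes all of them,
and it would be empty. *)
Lemma definable_saturation (D : nat -> set (seq K)) :
  (forall m, definable (D m)) -> (forall m, D m.+1 `<=` D m) ->
  (forall m, D m !=set0) ->
  exists a : nat -> K, forall k m,
    exists2 e, D m e & forall v, (v < k)%N -> e`_v = a v.
Proof.
move=> dD D_S D0.
have D_le m m' : (m <= m')%N -> D m' `<=` D m.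
  by move=> /subnK <-; elim: (m' - m)%N => //= i IH e /D_S /IH.
pose good s := forall m,
  exists2 e, D m e & forall v, (v < size s)%N -> e`_v = s`_v.
have extend s : exists a, good s -> good (rcons s a).
  have [gs|] := pselect (good s); last by exists 0.
  pose k := size s.
  pose C m a := exists2 e, D m e &
    forall v, (v < k.+1)%N -> e`_v = (set_nth 0 s k a)`_v.
  suff [a Ca] : exists a, forall m, C m a.
    exists a => _ m; have [e De ea] := Ca m; exists e => // v.
    rewrite size_rcons => vk; rewrite ea // nth_set_nth /= nth_rcons.
    by move: vk; rewrite ltnS leq_eqVlt => /orP[/eqP->|vk];
      rewrite ?eqxx ?ltnn ?vk// (ltn_eqF vk).
  have C_le m m' a : (m <= m')%N -> C m' a -> C m a.
    by move=> mm' [e De ea]; exists e => //; exact: D_le De.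
  have C0 m : exists a, C m a.
    have [e De es] := gs m; exists (e`_k), e => // v.
    rewrite nth_set_nth /=; case: eqP => [-> //|/eqP vk].
    by rewrite ltnS leq_eqVlt (negbTE vk) => /es.
  have lineC m : exists p : {poly K}, p != 0 /\
      ((forall a, ~~ root p a -> C m a) \/ (forall a, ~~ root p a -> ~ C m a)).
    have [p p0 pC] := definable_line s k (definable_projection k.+1 (dD m)).
    by exists p.
  have [p pC] := choice lineC.
  have [allC|] := pselect (forall m a, ~~ root (p m) a -> C m a).
    have [|a pa] := @uncountable p; first by move=> m; case: (pC m).
    by exists a => m; apply: allC.
  move=> /existsNP[m0 nC0]; have [p0 [//|finC]] := pC m0.
  apply: contrapT => /forallNP noa.
  have /choice[bad badP] a : exists m, ~ C m a by exact/existsNP/noa.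
  have [rs prs] := closed_field_poly_normal (p m0).
  pose M := maxn m0 (\max_(a <- rs) bad a).
  have [a CMa] := C0 M; apply: (badP a); apply: (C_le _ M) => [|//].
  have : C m0 a by apply: C_le CMa; exact: leq_maxl.
  have [ra _|/finC //] := boolP (root (p m0) a).
  have ars : a \in rs.
    by move: ra; rewrite prs rootZ ?lead_coef_eq0// root_prod_XsubC.
  by rewrite leq_max; apply/orP; right; apply: leq_bigmax_seq.
have [next nextP] := choice extend.
pose s := fix s k := if k is k'.+1 then rcons (s k') (next (s k')) else [::].
have sz k : size (s k) = k by elim: k => //= k IH; rewrite size_rcons IH.
have gs k : good (s k).
  elim: k => [m|k IH]; last exact: nextP.
  by have [e De] := D0 m; exists e.
pose a v := (s v.+1)`_v.
have sa k v : (v < k)%N -> (s k)`_v = a v.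
  elim: k => // k IH; rewrite ltnS leq_eqVlt => /orP[/eqP->//|vk].
  by rewrite /= nth_rcons sz vk IH.
by exists a => k m; have [e De es] := gs k m; exists e => // v vk;
  rewrite es ?sz// sa.
Qed.

End Definable.

(** The real numbers among the roots form a countable set, hence a Lebesgue null
set, which cannot contain the unit interval. *)
Lemma complex_avoids_roots (R : realType) : avoids_roots R[i].
Proof.
move=> p p0; apply: contrapT => /forallNP noa.
have cA : cardinality.countable (\bigcup_m [set x : R | root (p m) x%:C%C]).
  apply: cardinality.bigcup_countable => // m _.
  have [rs prs] := closed_field_poly_normal (p m).
  apply: cardinality.finite_set_countable.
  apply: (@cardinality.sub_finite_set _ _ [set` [seq complex.Re z | z <- rs]]).
    move=> x /=; rewrite prs rootZ ?lead_coef_eq0// root_prod_XsubC => xr.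
    by apply/mapP; exists x%:C%C.
  exact: cardinality.finite_seq.
have : cardinality.countable [set` `[0, 1 : R]].
  apply: cardinality.sub_countable cA; apply: cardinality.subset_card_le.
  move=> x _; have /existsNP[m /negP] := noa x%:C%C.
  by rewrite negbK; exists m.
move=> /lebesgue_measure.countable_lebesgue_measure0.
rewrite lebesgue_measure.lebesgue_measure_itv /= constructive_ereal.lte_fin.
rewrite ltr01 constructive_ereal.sube0 => /(congr1 constructive_ereal.fine) /eqP.
by rewrite oner_eq0.
Qed.

(** * Evaluation of polynomials at truncated power series *)

Lemma mpoly_ring_ind (R : nzRingType) N (P : {mpoly R[N]} -> Prop) :
  (forall c, P c%:MP) -> (forall i, P 'X_i) ->
  (forall p q, P p -> P q -> P (p + q)) ->
  (forall p q, P p -> P q -> P (p * q)) -> forall p, P p.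
Proof.
move=> PC PX PD PM p; rewrite [p]mpolyE.
apply: big_ind => [|//|m _]; first by rewrite -mpolyC0.
rewrite -mul_mpolyC; apply: (PM _ _ (PC _)); rewrite mpolyXE_id.
have P1 : P 1 by rewrite -mpolyC1.
apply: big_ind => // i _; elim: (m i) => // k IH.
by rewrite exprS; apply: PM.
Qed.

Lemma rmorph_mmap (R : nzRingType) (S T : comNzRingType) N
    (f : {rmorphism R -> S}) (f' : {rmorphism R -> T}) (phi : {rmorphism S -> T})
    (h : 'I_N -> S) (h' : 'I_N -> T) (p : {mpoly R[N]}) :
  phi \o f =1 f' -> phi \o h =1 h' -> phi (mmap f h p) = mmap f' h' p.
Proof.
move=> ff' hh'; elim/mpoly_ring_ind: p => [c|i|p q IH IH'|p q IH IH'].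
- by rewrite !mmapC; apply: ff'.
- by rewrite !mmapX !mmap1U; apply: hh'.
- by rewrite !mmapD rmorphD IH IH'.
- by rewrite !rmorphM /= IH IH'.
Qed.

Section TruncatedPolynomials.
Variables (K : fieldType) (n : nat).
Local Notation Q := {poly %/ ('X^(n.+1) : {poly K})}.

Lemma qpolyXn_eqP (r s : Q) : (forall j, (j < n.+1)%N -> r`_j = s`_j) -> r = s.
Proof.
move=> rs; apply/val_inj/polyP => j /=.
have [|nj] := ltnP j n.+1; first exact: rs.
have big (t : Q) : t`_j = 0.
  apply: nth_default; apply: leq_trans (size_npoly t) _.
  by rewrite mk_monic_Xn size_polyXn.
by rewrite !big.
Qed.

Lemma qpolyXn_coef0M (r s : Q) : (r * s)`_0 = r`_0 * s`_0.
Proof.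
change (r * s) with (in_qpoly 'X^(n.+1) ((r : {poly K}) * s)).
by rewrite in_qpoly_coef /= coef0M.
Qed.

(** A polynomial with nonzero constant term is prime to ['X], and a Bezout
relation gives the inverse. *)
Lemma qpolyXn_inv (r : Q) : r`_0 != 0 -> exists s : Q, r * s = 1.
Proof.
move=> r0; have : coprimep (r : {poly K}) 'X^(n.+1).
  by rewrite coprimep_expr // coprimepX rootE horner_coef0.
case/Bezout_eq1_coprimepP => -[u v] /= uv; exists (in_qpoly 'X^(n.+1) u).
have inK : in_qpoly 'X^(n.+1) (r : {poly K}) = r.
  by apply: qpolyXn_eqP => j jn; rewrite in_qpoly_coef jn.
rewrite -{1}inK -in_qpolyM -(in_qpoly1 'X^(n.+1)) -uv mulrC in_qpolyD.
apply: qpolyXn_eqP => j jn; rewrite coefD [X in _ + X](_ : _ = 0) ?addr0 //.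
by rewrite in_qpoly_coef jn coefMXn jn.
Qed.

Lemma qpolyXn_lreg (r s t : Q) : t`_0 != 0 -> r * t = s * t -> r = s.
Proof.
move=> /qpolyXn_inv[u tu] rs.
by rewrite -[r]mulr1 -[s]mulr1 -tu !mulrA rs.
Qed.

Lemma mmap_qpolyC_coef0 N (c : 'I_N -> Q) (p : {mpoly K[N]}) :
  (mmap (qpolyC 'X^(n.+1)) c p)`_0 = p.@[fun i => (c i)`_0].
Proof.
elim/mpoly_ring_ind: p => [a|i|p q IH IH'|p q IH IH'].
- by rewrite mmapC mevalC /= coefC.
- by rewrite mmapX mmap1U mevalXU.
- by rewrite mmapD mevalD coefD IH IH'.
- by rewrite rmorphM /= qpolyXn_coef0M mevalM IH IH'.
Qed.

End TruncatedPolynomials.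

(** * Jets in an affine chart *)

Section Chart.
Variables (K : fieldType) (X : variety K).
Variables (U : set X) (N : nat) (y : X -> 'I_N -> K).
Hypothesis chart_y : affine_chart (@regular_at K X) U y.
Variable n : nat.
Local Notation Q := {poly %/ ('X^(n.+1) : {poly K})}.
Local Notation ev := (mmap (qpolyC 'X^(n.+1))).
Implicit Types (g : jet X n) (p q : {mpoly K[N]}).

Lemma regular_chartP x f : U x ->
  regular_at x f <-> exists p q, \forall z \near x,
    q.@[y z] != 0 /\ f z = p.@[y z] / q.@[y z].
Proof. by case: chart_y => _ _ _ _; apply. Qed.

Lemma regular_poly x p : U x -> regular_at x (fun z => p.@[y z]).
Proof.
move=> Ux; apply/(regular_chartP _ Ux); exists p, 1.
by apply: nearW => z; rewrite meval1 oner_eq0 divr1.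
Qed.

Lemma jet_poly g p : U (jet_base g) ->
  g (fun z => p.@[y z]) = ev (fun i => g (y^~ i)) p.
Proof.
move=> Ug; have reg q := regular_poly q Ug.
elim/mpoly_ring_ind: p => [c|i|p q IH IH'|p q IH IH'].
- rewrite mmapC; transitivity (g (cst c)); last exact: jet_cst.
  by congr (g _); apply/funext => z; rewrite mevalC.
- by rewrite mmapX mmap1U; congr (g _); apply/funext => z; rewrite mevalXU.
- rewrite mmapD -IH -IH' -jet_add//; congr (g _).
  by apply/funext => z; rewrite mevalD.
- rewrite rmorphM /= -IH -IH' -jet_mul//; congr (g _).
  by apply/funext => z; rewrite mevalM.
Qed.

Lemma jet_poly_coef0 g p : U (jet_base g) ->
  (g (fun z => p.@[y z]))`_0 = p.@[y (jet_base g)].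
Proof. by move=> Ug; apply/jet_local/regular_poly. Qed.

Lemma jet_eq g g' : jet_base g = jet_base g' -> (g : _ -> _) =1 g' -> g = g'.
Proof.
case: g => b m H1 H2 H3 H4 H5 H6; case: g' => b' m' H1' H2' H3' H4' H5' H6' /=.
move=> e /funext e'; case: _ / e e' H1' H2' H3' H4' H5' H6'.
by move=> <- *; congr Jet; apply: Prop_irrelevance.
Qed.

(** The constant terms of the coordinates give the base point. Near it a regular
function is a quotient [p / q] of polynomials in the coordinates, and the value
of the jet on [q] can be cancelled since its constant term is nonzero. *)
Lemma jet_chart_inj g g' : U (jet_base g) -> U (jet_base g') ->
  (forall i, g (y^~ i) = g' (y^~ i)) -> g = g'.
Proof.
move=> Ug Ug' gg'.
have yE i x : y x i = ('X_i : {mpoly K[N]}).@[y x] by rewrite mevalXU.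
have ygg' : jet_base g = jet_base g'.
  have [_ inj_y _ _ _] := chart_y; apply: inj_y; rewrite ?inE //.
  apply/funext => i; rewrite !yE -!jet_poly_coef0 //.
  by rewrite !jet_poly // !mmapX !mmap1U gg'.
have polygg' p : g (fun z => p.@[y z]) = g' (fun z => p.@[y z]).
  by rewrite !jet_poly//; congr mmap; apply/funext.
apply: jet_eq => // f.
have [rf|nrf] := pselect (regular_at (jet_base g) f); last first.
  by rewrite !jet_out // -ygg'.
have [p [q fpq]] := (regular_chartP f Ug).1 rf.
have fq (g1 : jet X n) : jet_base g1 = jet_base g ->
    g1 f * g1 (fun z => q.@[y z]) = g1 (fun z => p.@[y z]).
  move=> g1g; rewrite -jet_mul ?g1g//; last exact: regular_poly.
  apply: jet_germ; rewrite g1g; apply: filterS fpq => z [q0 fz] /=.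
  by rewrite fz divfK.
apply: (@qpolyXn_lreg _ _ _ _ (g (fun z => q.@[y z]))).
  by rewrite jet_poly_coef0//; case: (nbhs_singleton fpq).
by rewrite fq// !polygg' fq.
Qed.

(** Conversely, let the truncated polynomials [c] annihilate the polynomials
that vanish on [U]. A jet with coordinates [c] must be based at the point of [U]
given by their constant terms, and must send a function that is [p / q] near
that point to [p(c) / q(c)]. *)
Section JetOfCoordinates.
Variable c : 'I_N -> Q.
Hypothesis c_vanish : forall p, (forall z, U z -> p.@[y z] = 0) -> ev c p = 0.

Lemma chart_base : exists2 x, U x & forall i, y x i = (c i)`_0.
Proof.
have [_ _ [S yU] _ _] := chart_y.
have : (y @` U) (fun i => (c i)`_0).
  rewrite yU => p Sp /=; rewrite -mmap_qpolyC_coef0 c_vanish ?coef0// => z Uz.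
  have : (y @` U) (y z) by exists z.
  by rewrite yU => /(_ p Sp).
by move=> [x Ux yx]; exists x => // i; rewrite yx.
Qed.

Variable x : X.
Hypotheses (Ux : U x) (yx : forall i, y x i = (c i)`_0).

Lemma ev_coef0 p : (ev c p)`_0 = p.@[y x].
Proof. by rewrite mmap_qpolyC_coef0; congr meval; apply/funext. Qed.

(** The defining equation is [r = p(c) / q(c)] with the denominator cleared. *)
Definition germ_value (f : X -> K) (r : Q) := exists p q,
  (\forall z \near x, q.@[y z] != 0 /\ f z = p.@[y z] / q.@[y z]) /\
  r * ev c q = ev c p.

(** Two fractions that agree near [x] agree on the trace on [U] of a basic open
set on which some polynomial [h] does not vanish. So [h * (p * q' - p' * q)]
vanishes on [U] and is annihilated by [c], and [h(c)] can be cancelled. *)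
Lemma germ_value_unique f f' r r' : (\forall z \near x, f z = f' z) ->
  germ_value f r -> germ_value f' r' -> r = r'.
Proof.
move=> ff' [p [q [fpq rpq]]] [p' [q' [fpq' rpq']]].
have [q0 _] := nbhs_singleton fpq; have [q'0 _] := nbhs_singleton fpq'.
suff evE : ev c p * ev c q' = ev c p' * ev c q.
  apply: (@qpolyXn_lreg _ _ _ _ (ev c q * ev c q')).
    by rewrite qpolyXn_coef0M !ev_coef0 mulf_neq0.
  by rewrite mulrA rpq evE -rpq' mulrA mulrAC.
have [oU _ _ openU _] := chart_y.
have : nbhs x [set z | p.@[y z] * q'.@[y z] = p'.@[y z] * q.@[y z]].
  apply: filterS (filterI ff' (filterI fpq fpq')) => z.
  move=> [/= ff'z [[qz fz] [q'z f'z]]] /=; apply/eqP.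
  by rewrite -eqr_div// -fz -f'z ff'z.
rewrite nbhsE => -[W [oW Wx] Wpq].
have [O oO WO] : exists2 O, zariski_open O & U `&` W = U `&` y @^-1` O.
  by apply/openU => [z []//|]; apply: openI.
have [S OS] := (zariski_openP O).1 oO.
have [h Sh hx] : exists2 h, S h & h.@[y x] != 0.
  have : (U `&` W) x by split.
  by rewrite WO OS => -[].
have : ev c (h * (p * q' - p' * q)) = 0.
  apply: c_vanish => z Uz; rewrite mevalM mevalB !mevalM.
  have [->|hz] := eqVneq h.@[y z] 0; first by rewrite mul0r.
  have : (U `&` W) z by rewrite WO OS; split=> //; exists h.
  by move=> [_ /Wpq/= ->]; rewrite subrr mulr0.
rewrite rmorphM rmorphB !rmorphM /= -[RHS](mul0r (ev c h)) mulrC => H.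
by apply: subr0_eq; move: H; apply: qpolyXn_lreg; rewrite ev_coef0.
Qed.

Lemma germ_value_regular f : regular_at x f <-> exists r, germ_value f r.
Proof.
rewrite (regular_chartP _ Ux); split=> [[p [q fpq]]|[r [p [q [fpq _]]]]].
  have [q0 _] := nbhs_singleton fpq.
  have [s qs] : exists s, ev c q * s = 1 by apply: qpolyXn_inv; rewrite ev_coef0.
  by exists (ev c p * s), p, q; split=> //; rewrite -mulrA [s * _]mulrC qs mulr1.
by exists p, q.
Qed.

Lemma germ_value_poly p : germ_value (fun z => p.@[y z]) (ev c p).
Proof.
exists p, 1; split; last by rewrite rmorph1 mulr1.
by apply: nearW => z; rewrite meval1 oner_eq0 divr1.
Qed.

Lemma germ_valueD f f' r r' :
  germ_value f r -> germ_value f' r' -> germ_value (f \+ f') (r + r').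
Proof.
move=> [p [q [fpq rpq]]] [p' [q' [fpq' rpq']]].
exists (p * q' + p' * q), (q * q'); split; last first.
  rewrite rmorphD !rmorphM /= -rpq -rpq' mulrDl -!mulrA.
  by congr (_ + r' * _); rewrite mulrC.
apply: filterS2 fpq fpq' => z [q0 fz] [q'0 f'z].
by rewrite mevalD !mevalM mulf_neq0//= fz f'z addf_div.
Qed.

Lemma germ_valueM f f' r r' :
  germ_value f r -> germ_value f' r' -> germ_value (f \* f') (r * r').
Proof.
move=> [p [q [fpq rpq]]] [p' [q' [fpq' rpq']]].
exists (p * p'), (q * q'); split; last by rewrite !rmorphM /= -rpq -rpq' mulrACA.
apply: filterS2 fpq fpq' => z [q0 fz] [q'0 f'z].
by rewrite !mevalM mulf_neq0//= fz f'z mulf_div.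
Qed.

Lemma germ_value_coef0 f r : germ_value f r -> r`_0 = f x.
Proof.
move=> [p [q [fpq rpq]]]; have [q0 ->] := nbhs_singleton fpq.
by rewrite -[LHS](mulfK q0) -!ev_coef0 -qpolyXn_coef0M rpq.
Qed.

Lemma jet_of_germ_values :
  exists2 g : jet X n, jet_base g = x & forall p, g (fun z => p.@[y z]) = ev c p.
Proof.
have /choice[m mP] f : exists r,
    (regular_at x f -> germ_value f r) /\ (~ regular_at x f -> r = 0).
  have [rf|nrf] := pselect (regular_at x f); last by exists 0.
  by have [r fr] := (germ_value_regular f).1 rf; exists r.
have mE f r : germ_value f r -> m f = r.
  move=> fr; have rf : regular_at x f by apply/germ_value_regular; exists r.
  by apply: germ_value_unique ((mP f).1 rf) fr; apply: nearW.
have germ f f' : (\forall z \near x, f z = f' z) -> m f = m f'.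
  move=> ff'; have [[r fr]|nf] := pselect (exists r, germ_value f r).
    rewrite (mE _ _ fr); apply/esym/mE; move: fr => [p [q [fpq rpq]]].
    exists p, q; split=> //.
    by apply: filterS2 ff' fpq => z <-.
  rewrite (mP f).2; last by rewrite germ_value_regular.
  rewrite (mP f').2// germ_value_regular => -[r [p [q [fpq rpq]]]]; apply: nf.
  exists r, p, q; split=> //.
  by apply: filterS2 ff' fpq => z ->.
have cst_m a : m (cst a) = qpolyC 'X^(n.+1) a.
  have := germ_value_poly a%:MP; rewrite mmapC => /mE <-; congr m.
  by apply/funext => z; rewrite mevalC.
have add_m f f' : regular_at x f -> regular_at x f' -> m (f \+ f') = m f + m f'.
  by move=> rf rf'; apply/mE/germ_valueD; apply: (mP _).1.
have mul_m f f' : regular_at x f -> regular_at x f' -> m (f \* f') = m f * m f'.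
  by move=> rf rf'; apply/mE/germ_valueM; apply: (mP _).1.
have local_m f : regular_at x f -> (m f)`_0 = f x.
  by move=> rf; apply/germ_value_coef0/(mP f).1.
exists (Jet germ cst_m add_m mul_m local_m (fun f => (mP f).2)) => //= p.
exact/mE/germ_value_poly.
Qed.

End JetOfCoordinates.

Lemma jet_of_coordinates (c : 'I_N -> Q) :
  (forall p, (forall z, U z -> p.@[y z] = 0) -> ev c p = 0) ->
  exists2 g, U (jet_base g) & forall i, g (y^~ i) = c i.
Proof.
move=> c_vanish; have [x Ux yx] := chart_base c_vanish.
have [g gx gp] := jet_of_germ_values c_vanish Ux yx.
exists g => [|i]; first by rewrite gx.
have := gp 'X_i; rewrite mmapX mmap1U => <-; congr (g _).
by apply/funext => z; rewrite mevalXU.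
Qed.

Lemma jet_coordinates_vanish g p : U (jet_base g) ->
  (forall z, U z -> p.@[y z] = 0) -> ev (fun i => g (y^~ i)) p = 0.
Proof.
move=> Ug pU; rewrite -jet_poly // -(qpolyC0 'X^(n.+1)) -(jet_cst g).
apply: jet_germ; have [oU _ _ _ _] := chart_y.
by apply: filterS (open_nbhs_nbhs (conj oU Ug)) => z /pU.
Qed.

End Chart.

(** * Definable sets of jets *)

Section JetEnvironments.
Variables (K : closedFieldType) (X : variety K).
Variables (U : set X) (N : nat) (y : X -> 'I_N -> K).
Hypothesis chart_y : affine_chart (@regular_at K X) U y.
Implicit Types (n : nat) (e : seq K).

(** The coefficient of [t^j] in the [i]-th coordinate is the variable number [j
* N + i]: coefficients are ordered by degree first, so that truncation of jets
keeps an initial segment of the variables. *)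
Definition encodes n e (g : jet X n) := U (jet_base g) /\
  forall (i : 'I_N) (j : 'I_n.+1), e`_(j * N + i) = (g (y^~ i))`_j.

Lemma coord_index_lt n (i : 'I_N) j : (j <= n)%N -> (j * N + i < n.+1 * N)%N.
Proof.
move=> jn; apply: (@leq_trans (j.+1 * N)).
  by rewrite mulSn addnC ltn_add2r.
by rewrite leq_mul2r ltnS jn orbT.
Qed.

Lemma encodes_exists n (g : jet X n) : U (jet_base g) -> exists e, encodes e g.
Proof.
move=> Ug; pose coord v :=
  if insub (v %% N)%N is Some i then (g (y^~ i))`_(v %/ N) else 0.
exists (mkseq coord (n.+1 * N)); split=> // i j.
have iN := ltn_ord i; have N0 : (0 < N)%N by apply: leq_trans iN.
rewrite nth_mkseq; last by apply: coord_index_lt; rewrite -ltnS.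
rewrite /coord modnMDl modn_small // divnMDl // divn_small // addn0.
by rewrite valK.
Qed.

Lemma encodes_trunc n e (g : jet X n.+1) : encodes e g -> encodes e (trunc g).
Proof.
move=> [Ug eg]; split=> // i j.
rewrite [RHS]qtrunc_coef ltn_ord.
exact: (eg i (widen_ord (leqnSn _) j)).
Qed.

Lemma encodes_inj n e (g g' : jet X n) : encodes e g -> encodes e g' -> g = g'.
Proof.
move=> [Ug eg] [Ug' eg']; apply: (jet_chart_inj chart_y) => // i.
apply: qpolyXn_eqP => j jn.
by rewrite -(eg i (Ordinal jn)) -(eg' i (Ordinal jn)).
Qed.

Lemma encodes_eq n e e' (g : jet X n) :
  (forall v, (v < n.+1 * N)%N -> e`_v = e'`_v) -> encodes e g -> encodes e' g.
Proof.
move=> ee' [Ug eg]; split=> // i j; rewrite -eg -ee'//.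
by apply: coord_index_lt; rewrite -ltnS.
Qed.

(** The numbering of the variables by [encodes], transported to the numbering of
the coordinates by [jet_coords]. *)
Definition coord_index n (k : 'I_(N * n.+1)) : nat :=
  mxvec (\matrix_(i < N, j < n.+1) (j * N + i)%N) 0 k.

Lemma coord_indexE n i j : @coord_index n (mxvec_index i j) = (j * N + i)%N.
Proof. by rewrite /coord_index mxvecE mxE. Qed.

Lemma jet_coords_encodes n e (g : jet X n) : encodes e g ->
  jet_coords y g = fun k => e`_(coord_index k).
Proof.
move=> [_ eg]; apply/funext => k; case/mxvec_indexP: k => i j.
by rewrite coord_indexE eg /jet_coords mxvecE mxE.
Qed.

(** Coordinate tuples of jets are the solutions of polynomial equations, the
coefficients of [p(c)] for the polynomials [p] vanishing on [U]. These equations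
are read off from the evaluation [P p] of [p] at the generic tuple, whose
coefficients are indeterminates. *)
Lemma encodable_definable n :
  definable [set e | exists g : jet X n, encodes e g].
Proof.
pose V (p : {mpoly K[N]}) := forall z, U z -> p.@[y z] = 0.
pose R := {mpoly K[N * n.+1]}.
pose P := mmap (polyC \o @mpolyC (N * n.+1) K : {rmorphism K -> {poly R}})
  (fun i : 'I_N => \sum_(j < n.+1) ('X_(mxvec_index i j) : R)%:P * 'X^j).
pose S : set R :=
  [set s | exists2 p, V p & exists2 j, (j < n.+1)%N & s = (P p)`_j].
have SO : zariski_open
    (~` [set x : 'I_(N * n.+1) -> K | forall s, S s -> s.@[x] = 0]).
  by exists S; rewrite setCK.
have := definableC (zariski_open_definable (@coord_index n) SO).
congr definable; apply/seteqP.
pose c e (i : 'I_N) : {poly K} :=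
  \sum_(j < n.+1) (e`_(j * N + i))%:P * 'X^j.
have cE e i j : (j < n.+1)%N -> (c e i)`_j = e`_(j * N + i).
  move=> jn; rewrite coef_sum (bigD1 (Ordinal jn)) //= coefCM coefXn eqxx mulr1.
  rewrite big1 ?addr0// => k kj; rewrite coefCM coefXn eq_sym.
  rewrite (_ : (_ == _) = false) ?mulr0//.
  by apply: contraNF kj => /eqP kj; apply/eqP/val_inj.
pose q e i : {poly %/ ('X^(n.+1) : {poly K})} := in_qpoly 'X^(n.+1) (c e i).
have evE e p j : (j < n.+1)%N ->
    (mmap (qpolyC 'X^(n.+1)) (q e) p)`_j
    = ((P p)`_j).@[fun k => e`_(coord_index k)].
  move=> jn.
  pose E := mmap (polyC : {rmorphism K -> {poly K}}) (c e).
  have -> : mmap (qpolyC 'X^(n.+1)) (q e) p = in_qpoly 'X^(n.+1) (E p).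
    apply/esym/rmorph_mmap => // a.
    by apply: qpolyXn_eqP => i ij; rewrite /= in_qpoly_coef ij.
  rewrite in_qpoly_coef jn.
  have -> : E p = map_poly (meval (fun k => e`_(coord_index k))) (P p).
    apply/esym/rmorph_mmap => [a|i] /=; first by rewrite map_polyC /= mevalC.
    rewrite rmorph_sum /=; apply: eq_bigr => k _.
    by rewrite rmorphM /= map_polyC map_polyXn /= mevalXU coord_indexE.
  by rewrite coef_map.
split=> e /=.
  move=> /contrapT eS.
  have [p Vp|g Ug gq] := jet_of_coordinates chart_y (c := q e).
    apply: qpolyXn_eqP => j jn; rewrite evE // coef0; apply: eS.
    by exists p => //; exists j.
  exists g; split=> // i j; rewrite gq in_qpoly_coef ltn_ord cE //.
move=> [g [Ug eg]]; apply => s [p Vp [j jn ->]].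
rewrite -evE //.
have -> : q e = fun i => g (y^~ i).
  apply/funext => i; apply: qpolyXn_eqP => k kn.
  by rewrite in_qpoly_coef kn cE // -(eg i (Ordinal kn)).
by rewrite (jet_coordinates_vanish chart_y) // coef0.
Qed.

(** [D] is only constrained on environments that encode some jet, as the
condition of encoding a jet is imposed separately. *)
Definition jet_definable n (A : set (jet X n)) := exists2 D, definable D &
  forall e g, encodes e g -> (A g <-> D e).

Lemma jet_definable0 n : jet_definable (@set0 (jet X n)).
Proof. by exists set0; first exact: definable0. Qed.

Lemma jet_definableC n (A : set (jet X n)) :
  jet_definable A -> jet_definable (~` A).
Proof.
move=> [D dD AD]; exists (~` D); first exact: definableC.
by move=> e g /AD /= [? ?]; split; apply: contra_not.
Qed.

Lemma jet_definableI n (A B : set (jet X n)) :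
  jet_definable A -> jet_definable B -> jet_definable (A `&` B).
Proof.
move=> [D dD AD] [D' dD' BD]; exists (D `&` D'); first exact: definableI.
move=> e g eg; have [? ?] := AD e g eg; have [? ?] := BD e g eg.
by split=> -[]; split; auto.
Qed.

Lemma jet_definableU n (A B : set (jet X n)) :
  jet_definable A -> jet_definable B -> jet_definable (A `|` B).
Proof.
move=> dA dB; rewrite -[A `|` B]setCK setCU.
by apply/jet_definableC/jet_definableI; apply: jet_definableC.
Qed.

Lemma jet_definable_open n (A : set (jet X n)) : open A -> jet_definable A.
Proof.
rewrite jet_openE => /(_ _ _ _ chart_y)[O oO AO].
exists [set e | O (fun k => e`_(coord_index k))].
  exact: zariski_open_definable.
by move=> e g eg; have [Ug _] := eg; rewrite AO // (jet_coords_encodes eg).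
Qed.

Lemma jet_definable_constructible n (A : set (jet X n)) :
  constructible A -> jet_definable A.
Proof.
move=> [k [O [Z [oO cZ ->]]]].
have -> : \bigcup_i (O i `&` Z i) = \bigcup_(i in [set` enum 'I_k]) (O i `&` Z i).
  by congr bigcup; apply/seteqP; split => i //= _; rewrite mem_enum.
rewrite bigcup_seq; apply: big_ind => [||i _].
- exact: jet_definable0.
- exact: jet_definableU.
apply: jet_definableI; first exact: jet_definable_open.
rewrite -[Z i]setCK; apply/jet_definableC/jet_definable_open.
by rewrite openC.
Qed.

(** Adding one term [c i] times the indicator of [A i] shifts the value by [c i]
on [A i] and leaves it alone elsewhere. *)
Lemma jet_definable_fiber n (a : constrFun (jet X n)) (v : int) :
  jet_definable [set g | a g = v].
Proof.
have /asboolP[k [c [A [cA ->]]]] := constrFunP a.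
pose S (s : seq 'I_k) (w : int) : set (jet X n) :=
  [set g | \sum_(i <- s) c i * (g \in A i)%:R = w].
have step s w : jet_definable (S s w).
  elim: s w => [|i s IH] w.
    have [->|w0] := eqVneq w 0.
      have -> : S [::] 0 = ~` set0.
        by apply/seteqP; split=> g _ //; rewrite /S /= big_nil.
      exact/jet_definableC/jet_definable0.
    have -> : S [::] w = set0.
      apply/seteqP; split=> g //; rewrite /S /= big_nil => /esym/eqP.
      by rewrite (negbTE w0).
    exact: jet_definable0.
  have dA := jet_definable_constructible (cA i).
  have -> : S (i :: s) w = (A i `&` S s (w - c i)) `|` (~` A i `&` S s w).
    apply/seteqP; split=> g; rewrite /S /= big_cons.
      have [gA|gA] := pselect (A i g).
        rewrite mem_set // mulr1 => <-; left; split=> //.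
        by rewrite addrAC subrr add0r.
      by rewrite memNset // mulr0 add0r => <-; right.
    move=> [[gA ->]|[gA ->]]; first by rewrite mem_set // mulr1 addrC subrK.
    by rewrite memNset // mulr0 add0r.
  apply: jet_definableU; apply: jet_definableI => //.
  exact: jet_definableC.
exact: step.
Qed.

Hypothesis uncountable : avoids_roots K.

(** For [m >= n], [E m] describes the jets of order [m] above the support of
[a]. The scalars [s] that satisfy all [E m] at once are the coordinates of a jet
of each order, and these are compatible because coordinates determine jets. *)
Lemma arc_in_support n (a : constrFun (jet X n)) :
  (forall i, exists2 g : jet X (i + n),
     U (jet_base g) & dl_lift (@jet_pullback K X) i a g != 0) ->
  exists x : arc_space X, a (arc_jet x n) != 0.
Proof.
move=> nonzero.
have [D dD aD] := jet_definableC (jet_definable_fiber a 0).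
pose E m := [set e | exists g : jet X m, encodes e g] `&` D.
have E_S m : E m.+1 `<=` E m.
  by move=> e [[g eg] De]; split=> //; exists (trunc g); apply: encodes_trunc.
have descend e i (g : jet X (i + n)) : encodes e g ->
    dl_lift (@jet_pullback K X) i a g != 0 -> D e.
  elim: i g => [|i IH] g eg /= ag; last exact: (IH (trunc g) (encodes_trunc eg)).
  by apply/(aD _ _ eg)/eqP.
have E0 m : E m !=set0.
  have [g Ug ag] := nonzero m; have [e eg] := encodes_exists Ug.
  have E_add k : E (m + k)%N `<=` E m.
    by elim: k => [|k IH]; rewrite ?addn0 // addnS => e' /E_S /IH.
  exists e; apply: (E_add n).
  by split; [exists g|apply: descend eg ag].
have dE m : definable (E m).
  by apply: definableI dD; apply: encodable_definable.
have [s sP] := definable_saturation uncountable dE E_S E0.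
have gex m : exists g : jet X m, exists2 e,
    encodes e g /\ D e & forall v, (v < m.+1 * N)%N -> e`_v = s v.
  by have [e [[g eg] De] es] := sP (m.+1 * N)%N m; exists g, e.
pose g m := projT1 (cid (gex m)).
have gP m : exists2 e, encodes e (g m) /\ D e &
    forall v, (v < m.+1 * N)%N -> e`_v = s v by exact: (projT2 (cid (gex m))).
have g_trunc m : trunc (g m.+1) = g m.
  have [e [/encodes_trunc eg _] es] := gP m.+1.
  have [e' [eg' _] es'] := gP m.
  apply: encodes_inj eg _; apply: encodes_eq eg' => v vm.
  by rewrite es' // es // (leq_trans vm) // leq_mul2r leqnSn orbT.
exists (Arc g_trunc) => /=; have [e [eg De] _] := gP n.
by apply/eqP/(aD _ _ eg).
Qed.

End JetEnvironments.

(** * Injectivity of functionization *)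

(** A class that is not 0 has nonzero representatives at all later stages. As
finitely many charts cover [X], some chart contains, for every [m], a jet at
which the pullback by [m] truncations is nonzero: otherwise each chart misses
such jets from some stage on, and from the largest of these stages on no chart
contains any. *)
Lemma Psi_injective (K : closedFieldType) (X : variety K) :
  avoids_roots K -> injective (@Psi K X).
Proof.
move=> uncountable; apply: raddf_inj => x.
have [n [a ->]] := dl_in_surj x => Psi0.
have a0 : arc_pullback a = 0 by rewrite -Psi_in.
apply: contrapT => an0.
have lift0 i : dl_lift (@jet_pullback K X) i a != 0.
  apply/eqP => ai; apply: an0.
  by rewrite -(dl_in_lift _ i) ai; apply: raddf0.
have [k [V [affV coverV]]] := variety_cover X.
pose meets i m := exists2 g : jet X (m + n),
  V i (jet_base g) & dl_lift (@jet_pullback K X) m a g != 0.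
have meets_S i m : meets i m.+1 -> meets i m.
  by move=> [g Vg ag]; exists (trunc g).
have meets_le i m m' : (m <= m')%N -> meets i m' -> meets i m.
  by move=> /subnK <-; elim: (m' - m)%N => //= j IH /meets_S.
have [i meets_i] : exists i, forall m, meets i m.
  apply: contrapT => /forallNP none.
  have /choice[m mP] i : exists m, ~ meets i m by exact/existsNP/none.
  pose M := \max_i m i.
  have [g ag] : exists g, dl_lift (@jet_pullback K X) M a g != 0.
    apply: contrapT => /forallNP ag; have /eqP := lift0 M; apply.
    by apply/val_inj/funext => g; apply/eqP; have /negP := ag g; rewrite negbK.
  have [i _ Vg] : (\bigcup_i V i) (jet_base g) by rewrite coverV.
  by apply: (mP i); apply: (meets_le _ _ M); [exact: leq_bigmax|exists g].
have [N [y chart_y]] := affV i.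
have [z az] := arc_in_support chart_y uncountable meets_i.
by move/eqP: az; apply; have := congr1 (fun f => f z) a0.
Qed.

Theorem mainTheorem13 (R : realType) (X : variety R[i]) :
  exists Phi : {additive Fpro X -> Fcyl X},
    (forall a : Fpro X, Phi a = Psi a :> (arc_space X -> int)) /\ bijective Phi.
Proof.
have cylP a : Psi a \in @cylinder_fun _ X by apply/asboolP; exists a.
pose phi a := CylinderFun (cylP a).
have phi_additive : zmod_morphism phi.
  by move=> a b; apply: val_inj; rewrite /= raddfB.
pose phi_mixin := GRing.isZmodMorphism.Build _ _ phi phi_additive.
pose Phi : {additive Fpro X -> Fcyl X} := HB.pack phi phi_mixin.
exists Phi; split=> //.
have PsiI : injective (@Psi R[i] X).
  exact: (@Psi_injective R[i] X (@complex_avoids_roots R)).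
have /choice[inv invP] (b : Fcyl X) : exists a, Psi a = b.
  by have /asboolP[a _ ab] := FcylP b; exists a.
exists inv => [a|b]; first by apply: PsiI; rewrite invP.
by apply: val_inj; rewrite /= invP.
Qed.
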